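(* Let $P$ be the open polyhedron consisting of $k\ge 3$ triangles $T_1,\dots,T_k$ arranged cyclically around a common vertex $v$, where consecutive triangles $T_i,T_{i+1}$ (indices mod $k$) share an edge incident to $v$, so that $v$ is an interior vertex and the boundary of $P$ is the closed cycle formed by the edges of the triangles opposite $v$. If $v$ has negative curvature (the sum of the angles of the $T_i$ at $v$ exceeds $2\pi$), then $P$ has no general unfolding.
   Context: A polyhedron is a connected set of closed planar polygons in $\mathbb{R}^3$ such that any intersection of two of them is a collection of common vertices and edges, and each edge is shared by at most two polygons; edges in only one polygon form the boundary. The curvature of a non-boundary vertex is $2\pi$ minus the sum of the face angles at it. A cutting of $P$ is a union $C$ of finitely many line segments on $P$ (possibly crossing faces), containing only finitely many boundary points of $P$, such that $P-C$ is connected and can be isometrically embedded in the plane without overlap; the result is a general unfolding. *)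

(* Defs.v *)
(* Points of R^3 are row vectors 'rV[R]_3,
   points of the plane are 'rV[R]_2, over an arbitrary R : realType.
   The topology on 'rV[R]_n is the (product) topology of MathComp-Analysis,
   which coincides with the Euclidean topology. Distances are Euclidean,
   defined explicitly below (MathComp's matrix norm is the max-norm). *)
From HB Require Import structures.
From mathcomp Require Import all_boot all_order all_algebra.
From mathcomp Require Import all_classical all_reals all_analysis.
Set Implicit Arguments. Unset Strict Implicit. Unset Printing Implicit Defensive.
Import Order.TTheory GRing.Theory Num.Theory.
Import numFieldNormedType.Exports.
Local Open Scope classical_set_scope.
Local Open Scope ring_scope.

Section Geometry.
Variable R : realType.

Definition dotv n (u w : 'rV[R]_n) : R := \sum_(j < n) u ord0 j * w ord0 j.
Definition dist2 n (u w : 'rV[R]_n) : R := dotv (u - w) (u - w).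

Definition seg n (a b : 'rV[R]_n) : set 'rV[R]_n :=
  [set x | exists t : R, 0 <= t <= 1 /\ x = a + t *: (b - a)].

Definition tri n (a b c : 'rV[R]_n) : set 'rV[R]_n :=
  [set x | exists s t : R, [/\ 0 <= s, 0 <= t, s + t <= 1 &
                              x = a + s *: (b - a) + t *: (c - a)]].

Definition angle_at n (a b c : 'rV[R]_n) : R :=
  acos (dotv (b - a) (c - a) /
        (Num.sqrt (dotv (b - a) (b - a)) * Num.sqrt (dotv (c - a) (c - a)))).

Definition fan_face k (v : 'rV[R]_3) (w : 'I_k -> 'rV[R]_3) (i : 'I_k) :=
  tri v (w i) (w (ordS i)).

Definition fan k (v : 'rV[R]_3) (w : 'I_k -> 'rV[R]_3) : set 'rV[R]_3 :=
  \bigcup_(i in [set: 'I_k]) fan_face v w i.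

Definition fan_boundary k (v : 'rV[R]_3) (w : 'I_k -> 'rV[R]_3) : set 'rV[R]_3 :=
  \bigcup_(i in [set: 'I_k]) seg (w i) (w (ordS i)).

Definition is_fan_polyhedron k (v : 'rV[R]_3) (w : 'I_k -> 'rV[R]_3) : Prop :=
  [/\ (forall i, \rank (col_mx (w i - v) (w (ordS i) - v)) = 2%N),
      injective w,
      (forall i, fan_face v w i `&` fan_face v w (ordS i) = seg v (w (ordS i))) &
      (forall i j, i != j -> j != ordS i -> i != ordS j ->
                   fan_face v w i `&` fan_face v w j = [set v])].

Definition fan_curvature k (v : 'rV[R]_3) (w : 'I_k -> 'rV[R]_3) : R :=
  2 * pi - \sum_(i < k) angle_at v (w i) (w (ordS i)).

Definition is_cutting (P Bd C : set 'rV[R]_3) : Prop :=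
  [/\ exists (m : nat) (a b : 'I_m -> 'rV[R]_3),
        (forall j, seg (a j) (b j) `<=` P) /\
        C = \bigcup_(j in [set: 'I_m]) seg (a j) (b j),
      finite_set (C `&` Bd) &
      connected (P `\` C)].

(* P - C embeds isometrically in the plane without overlap: an injective,
   continuous map f : P - C -> R^2 which is (locally) isometric on each face,
   i.e. a local isometry for the intrinsic metric of P - C. *)
Definition isometric_planar_embedding (faces : seq (set 'rV[R]_3))
    (P C : set 'rV[R]_3) (f : 'rV[R]_3 -> 'rV[R]_2) : Prop :=
  [/\ {in P `\` C &, injective f},
      {within P `\` C, continuous f} &
      (forall F, F \in faces -> forall x, (F `\` C) x ->
         exists2 e : R, 0 < e & forall y z, (F `\` C) y -> (F `\` C) z ->
           dist2 y x < e -> dist2 z x < e -> dist2 (f y) (f z) = dist2 y z)].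

Definition has_general_unfolding k (v : 'rV[R]_3) (w : 'I_k -> 'rV[R]_3) : Prop :=
  exists C : set 'rV[R]_3,
    is_cutting (fan v w) (fan_boundary v w) C /\
    exists f : 'rV[R]_3 -> 'rV[R]_2,
      isometric_planar_embedding [seq fan_face v w i | i <- enum 'I_k]
                                 (fan v w) C f.

End Geometry.

(* Main.v *)
(* Around each point of P - C the map f agrees with an affine isometry on every
   face; all these isometries agree on the image of v, and this image is locally
   constant, hence a single point q with |f x - q| = |x - v| on the connected
   set P - C.  Take a small circle of radius r about v in P: its length exceeds
   2 pi r, it meets C in finitely many points, and f maps the remaining arcs
   injectively and with unit speed into the planar circle of radius r about q.
   Cutting the circle into arcs of angle 2 pi / N, each arc missing C is rotated
   onto an arc that contains a point of a fixed regular N-gon, and for large N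
   there are more than N such arcs. *)
Require Import Defs.
From HB Require Import structures.
From mathcomp Require Import all_boot all_order all_algebra.
From mathcomp Require Import all_classical all_reals all_analysis.
From mathcomp Require Import zify ring lra.
Set Implicit Arguments.
Unset Strict Implicit.
Unset Printing Implicit Defensive.
Import Order.TTheory GRing.Theory Num.Theory.
Import numFieldNormedType.Exports.
Local Open Scope classical_set_scope.
Local Open Scope ring_scope.

(** * Euclidean dot products and squared distances *)

Section Dot.
Variables (R : realType) (n : nat).
Implicit Types x y z : 'rV[R]_n.

Lemma dotvC x y : dotv x y = dotv y x.
Proof. by apply: eq_bigr => i _; rewrite mulrC. Qed.

Lemma dotvDl x y z : dotv (x + y) z = dotv x z + dotv y z.
Proof. by rewrite -big_split; apply: eq_bigr => i _; rewrite !mxE mulrDl. Qed.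

Lemma dotvZl c x y : dotv (c *: x) y = c * dotv x y.
Proof. by rewrite mulr_sumr; apply: eq_bigr => i _; rewrite !mxE mulrA. Qed.

Lemma dotvDr x y z : dotv z (x + y) = dotv z x + dotv z y.
Proof. by rewrite dotvC dotvDl !(dotvC z). Qed.

Lemma dotvZr c x y : dotv x (c *: y) = c * dotv x y.
Proof. by rewrite dotvC dotvZl dotvC. Qed.

Lemma dotvNl x y : dotv (- x) y = - dotv x y.
Proof. by rewrite -scaleN1r dotvZl mulN1r. Qed.

Lemma dotvNr x y : dotv x (- y) = - dotv x y.
Proof. by rewrite dotvC dotvNl dotvC. Qed.

Definition dotvE := (dotvDl, dotvDr, dotvNl, dotvNr, dotvZl, dotvZr).

Lemma dotv_ge0 x : 0 <= dotv x x.
Proof. by apply: sumr_ge0 => i _; rewrite -expr2 sqr_ge0. Qed.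

Lemma dotv_eq0 x : (dotv x x == 0) = (x == 0).
Proof.
apply/idP/eqP => [|->]; last by rewrite /dotv big1// => i _; rewrite mxE mul0r.
rewrite psumr_eq0 => [/allP h|i _]; last by rewrite -expr2 sqr_ge0.
apply/rowP => i; have := h i; rewrite mem_index_enum => /(_ isT).
by rewrite mxE -expr2 sqrf_eq0 => /eqP.
Qed.

Lemma dist2xx x : dist2 x x = 0.
Proof. by apply/eqP; rewrite dotv_eq0 subrr. Qed.

Lemma dist2_continuous y : continuous (fun x => dist2 x y).
Proof.
rewrite /dist2 /dotv; apply: continuous_big => [|i _]; first exact: add_continuous.
rewrite (_ : (fun x => _) =
    (fun t : R => (t - y ord0 i) * (t - y ord0 i)) \o (fun x => x ord0 i)).
  move=> x; apply: continuous_comp; first exact: coord_continuous.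
  by apply: cvgM; apply: cvgB; [exact: cvg_id|exact: cvg_cst|exact: cvg_id|
    exact: cvg_cst].
by apply/funext => x; rewrite /= !mxE.
Qed.

End Dot.

(** Each cross term is [2 * dotv x y = dotv x x + dotv y y - dist2 x y]; since the weights sum to
    zero, the squared norms cancel. *)
Lemma dotv_affine4 (R : realType) n (x1 x2 x3 x4 : 'rV[R]_n)
    (c1 c2 c3 c4 : R) : c1 + c2 + c3 + c4 = 0 ->
  dotv (c1 *: x1 + c2 *: x2 + c3 *: x3 + c4 *: x4)
       (c1 *: x1 + c2 *: x2 + c3 *: x3 + c4 *: x4) =
  - (c1 * c2 * dist2 x1 x2 + c1 * c3 * dist2 x1 x3 + c1 * c4 * dist2 x1 x4
     + c2 * c3 * dist2 x2 x3 + c2 * c4 * dist2 x2 x4 + c3 * c4 * dist2 x3 x4).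
Proof.
move=> c0; have -> : c1 = - (c2 + c3 + c4) by lra.
rewrite /dist2 !dotvE (dotvC x2 x1) (dotvC x3 x1) (dotvC x4 x1).
by rewrite (dotvC x3 x2) (dotvC x4 x2) (dotvC x4 x3); ring.
Qed.

(* The squared norm of an affine combination with zero total weight only
   depends on the pairwise distances. *)
Lemma isometry_affine4 (R : realType) n p (x1 x2 x3 x4 : 'rV[R]_n)
    (y1 y2 y3 y4 : 'rV[R]_p) (c1 c2 c3 c4 : R) :
  dist2 y1 y2 = dist2 x1 x2 -> dist2 y1 y3 = dist2 x1 x3 ->
  dist2 y1 y4 = dist2 x1 x4 -> dist2 y2 y3 = dist2 x2 x3 ->
  dist2 y2 y4 = dist2 x2 x4 -> dist2 y3 y4 = dist2 x3 x4 ->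
  c1 + c2 + c3 + c4 = 0 ->
  c1 *: x1 + c2 *: x2 + c3 *: x3 + c4 *: x4 = 0 ->
  c1 *: y1 + c2 *: y2 + c3 *: y3 + c4 *: y4 = 0.
Proof.
move=> d12 d13 d14 d23 d24 d34 c0 /eqP x0; apply/eqP; move: x0.
by rewrite -!dotv_eq0 !dotv_affine4// d12 d13 d14 d23 d24 d34.
Qed.

(** * Topological tools: connectedness and closed triangles *)

(** Read [Q i x] as: the value at [x] is [i]. The points of value [i] are open in [A] by
    persistence, and so is their complement, since by uniqueness another value persists there.
    [inhabited I] settles the case of empty [A]. *)
Lemma connected_locally_constant (T : topologicalType) (I : Type) (A : set T)
    (Q : I -> T -> Prop) : connected A -> inhabited I ->
  (forall x, A x -> exists i, Q i x) ->
  (forall i x, A x -> Q i x -> \forall y \near x, A y -> Q i y) ->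
  (forall i j x, A x -> Q i x -> Q j x -> i = j) ->
  exists i, forall x, A x -> Q i x.
Proof.
move=> Ac [i0] Qex Qnear Quniq.
have [[x0 Ax0]|A0] := pselect (exists x, A x); last first.
  by exists i0 => x Ax; case: A0; exists x.
have [i Qi] := Qex _ Ax0; exists i.
suff AE : A `&` [set x | Q i x] = A by move=> x Ax; rewrite -AE in Ax; case: Ax.
apply: Ac; first by exists x0.
- exists (interior [set y | A y -> Q i y]); first exact: open_interior.
  apply/seteqP; split=> x [Ax Qx]; split => //; first exact: Qnear.
  exact: (nbhs_singleton Qx).
- exists (~` interior [set y | A y -> ~ Q i y]).
    by apply: open_closedC; exact: open_interior.
  apply/seteqP; split=> x [Ax Qx]; split => //.
    by move=> /nbhs_singleton; exact.
  have [j Qj] := Qex _ Ax; apply: contrapT => nQ; apply: Qx.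
  have := Qnear _ _ Ax Qj; apply: filterS => y Qjy Ay Qiy.
  by apply: nQ; rewrite /= (Quniq _ _ _ Ay Qiy (Qjy Ay)).
Qed.

(** Segments are degenerate triangles, so [closed_tri] also yields the closedness of a cutting. *)
Lemma segE (R : realType) n (a b : 'rV[R]_n) : seg a b = tri a b b.
Proof.
apply/seteqP; split=> [x [t [/andP[t0 t1] ->]]|x [s [t [s0 t0 st ->]]]].
  by exists t, 0; split; rewrite ?addr0 ?scale0r ?addr0.
by exists (s + t); rewrite addr_ge0//= scalerDl addrA.
Qed.

Lemma line_continuous (R : realType) n (x d : 'rV[R]_n) :
  continuous (fun t : R => x + t *: d).
Proof.
move=> t; apply: cvgD; first exact: cvg_cst.
by apply: cvgZr_tmp; exact: cvg_id.
Qed.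

(** A triangle is a continuous image of the compact unit square: one coordinate is the fraction of
    the way from [a] to the opposite side, the other the position on that side. *)
Lemma closed_tri (R : realType) n (a b c : 'rV[R]_n) : closed (tri a b c).
Proof.
pose g (p : R * R) := a + p.1 *: ((1 - p.2) *: (b - a) + p.2 *: (c - a)).
have -> : tri a b c = g @` (`[0, 1] `*` `[0, 1]).
  apply/seteqP; split=> x.
    move=> [s [t [s0 t0 st1 ->]]].
    (* At the corner [a] the position [t / (s + t)] has no meaning, and [(0, 0)] is used. *)
    have [/eqP st0|st0] := boolP (s + t == 0).
      have [-> ->] : s = 0 /\ t = 0 by split; lra.
      by exists (0, 0); rewrite /g/= ?in_itv/= ?lexx ?ler01// !scale0r !addr0.
    have stp : 0 < s + t by rewrite lt_def st0 addr_ge0.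
    exists (s + t, t / (s + t)).
      rewrite /= !in_itv/= addr_ge0// st1 divr_ge0 ?(ltW stp)//=.
      by rewrite ler_pdivrMr// mul1r lerDr.
    rewrite /g/= scalerDr !scalerA addrA.
    by congr (_ + _ *: _ + _ *: _); field.
  move=> [[s u] /=]; rewrite !in_itv/= => -[/andP[s0 s1] /andP[u0 u1]] <-.
  exists (s * (1 - u)), (s * u); split; rewrite ?mulr_ge0 ?subr_ge0//.
    by rewrite -mulrDr subrK mulr1.
  by rewrite /g/= scalerDr !scalerA addrA.
apply: compact_closed; first exact: norm_hausdorff.
apply: continuous_compact; last by apply: compact_setX; exact: segment_compact.
apply: continuous_subspaceT => p; apply: cvgD; first exact: cvg_cst.
apply: cvgZ; first exact: cvg_fst.
apply: cvgD; apply: cvgZr_tmp; last exact: cvg_snd.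
by apply: cvgB; [exact: cvg_cst|exact: cvg_snd].
Qed.

Lemma tri_star (R : realType) n (a b c x : 'rV[R]_n) t : 0 <= t <= 1 ->
  tri a b c x -> tri a b c (x + t *: (a - x)).
Proof.
move=> /andP[t0 t1] [s [u [s0 u0 su ->]]].
exists ((1 - t) * s), ((1 - t) * u); split; rewrite ?mulr_ge0 ?subr_ge0//.
  by rewrite -mulrDr mulr_ile1 ?subr_ge0 ?addr_ge0//; lra.
by apply/rowP => j; rewrite !mxE; ring.
Qed.

(** * The common image [q] of the apex *)

Section ApexImage.
Variables (R : realType) (k n p : nat) (v : 'rV[R]_n).
Variables (F : 'I_k -> set 'rV[R]_n) (C : set 'rV[R]_n).
Variable f : 'rV[R]_n -> 'rV[R]_p.
Hypothesis closedF : forall i, closed (F i).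
Hypothesis starF :
  forall i x t, 0 <= t <= 1 -> F i x -> F i (x + t *: (v - x)).
Hypothesis closedC : closed C.
Hypothesis isomF : forall i x, (F i `\` C) x ->
  exists2 e : R, 0 < e & forall y z, (F i `\` C) y -> (F i `\` C) z ->
    dist2 y x < e -> dist2 z x < e -> dist2 (f y) (f z) = dist2 y z.

Let P := \bigcup_(i in [set: 'I_k]) F i.

(** The closed set [C] and the finitely many closed faces missing [x] can be avoided near [x]; on
    the faces through [x], [isomF] gives a radius. Hence one [U] serves all faces. *)
Lemma isometry_near x : ~ C x ->
  exists U : set 'rV[R]_n, [/\ open U, U x & forall i y, U y -> F i y ->
    [/\ ~ C y, F i x & forall z, U z -> F i z ->
                                 dist2 (f y) (f z) = dist2 y z]].
Proof.
move=> nCx.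
have near_x i : exists V, nbhs x V /\ forall y, V y -> F i y ->
    [/\ ~ C y, F i x & forall z, V z -> F i z -> dist2 (f y) (f z) = dist2 y z].
  have nearC : nbhs x (~` C).
    by apply: open_nbhs_nbhs; split => //; exact: closed_openC.
  have [Fx|nFx] := pselect (F i x); last first.
    exists (~` F i); split => //.
    by apply: open_nbhs_nbhs; split => //; exact: closed_openC.
  have [e e0 he] := isomF (conj Fx nCx).
  have neare : \forall y \near x, dist2 y x < e.
    by apply: cvgr_lt (@dist2_continuous R n x x) _ _; rewrite dist2xx.
  exists (~` C `&` [set y | dist2 y x < e]); split; first exact: filterI.
  by move=> y [nCy ye] Fy; split => // z [nCz ze] Fz; exact: he.
have [V hV] := choice near_x.
exists (interior [set y | forall i, V i y]); split.
- exact: open_interior.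
- exact: (@filter_forall _ _ V (nbhs x) _ (fun i => (hV i).1)).
- move=> i y /nbhs_singleton Vy Fy.
  have [nCy Fx hy] := (hV i).2 y (Vy i) Fy.
  by split => // z /nbhs_singleton Vz Fz; exact: hy.
Qed.

Let toward x t := x + t *: (v - x).

Lemma toward_near x (U : set 'rV[R]_n) : open U -> U x ->
  exists2 e : R, 0 < e <= 1 & forall t, 0 <= t <= e -> U (toward x t).
Proof.
move=> oU Ux; have : \forall t \near (0 : R), U (toward x t).
  apply: (@line_continuous R n x (v - x) 0).
  by rewrite /= scale0r addr0; exact: open_nbhs_nbhs.
move=> /nbhs_ballP[e /= e0 he].
(* The cap [1] keeps the moving point between [x] and [v], where [starF] applies; halving passes
   from the open ball to a closed interval. *)
exists (Num.min 1 (e / 2)); first by rewrite lt_min ltr01 divr_gt0//= ge_min lexx.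
move=> t /andP[t0]; rewrite le_min => /andP[t1 te]; apply: he.
by rewrite /ball/= sub0r normrN ger0_norm//; lra.
Qed.

(* [q] is where the affine extension of [f] around [x] sends [v]. *)
Let apex_at q x := exists2 e : R, 0 < e &
  forall t, 0 <= t <= e -> f (toward x t) = f x + t *: (q - f x).

(** The segment from [x] to [v] may run into [C], so only its beginning is used: [apex_at]
    extrapolates the image of this beginning to a point [q]. Connectedness makes [q] the same for
    all [x]. *)
Lemma apex_image : connected (P `\` C) ->
  exists q, forall x, (P `\` C) x -> dist2 (f x) q = dist2 x v.
Proof.
move=> Pc.
have [] := @connected_locally_constant _ 'rV[R]_p (P `\` C) apex_at Pc.
- exact: (inhabits 0).
- move=> x [[i _ Fx] nCx].
  have [U [oU Ux hU]] := isometry_near nCx.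
  have [e /andP[e0 e1] he] := toward_near oU Ux.
  (* The displacement of [f] over a step [e] towards [v], scaled up by [1 / e]. *)
  exists (f x + e^-1 *: (f (toward x e) - f x)); exists e => // t /andP[t0 te].
  have iso s s' : 0 <= s <= e -> 0 <= s' <= e ->
      dist2 (f (toward x s)) (f (toward x s')) = dist2 (toward x s) (toward x s').
    move=> hs hs'; have F' r : 0 <= r <= e -> F i (toward x r).
      by move=> /andP[r0 re]; apply: starF => //; rewrite r0 (le_trans re).
    by have [_ _] := hU i _ (he _ hs) (F' _ hs); apply; [exact: he|exact: F'].
  have x0 : toward x 0 = x by rewrite /toward scale0r addr0.
  (* The points at parameters [t], [e] and [0] are collinear; the fourth point is a repetition with
     weight zero. *)
  have := @isometry_affine4 R n p (toward x t) (toward x e) (toward x 0)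
    (toward x 0) (f (toward x t)) (f (toward x e)) (f (toward x 0))
    (f (toward x 0)) 1 (- (t / e)) (t / e - 1) 0.
  rewrite !iso ?lexx ?(ltW e0) ?t0//= => /(_ erefl erefl erefl erefl erefl erefl).
  have eN : e != 0 by rewrite gt_eqF.
  have -> : 1 - t / e + (t / e - 1) + 0 = 0 by ring.
  move=> /(_ erefl); rewrite x0 => H; apply/eqP; rewrite -subr_eq0 -[X in _ == X]H.
    by apply/eqP/rowP => j; rewrite !mxE; field.
  by apply/rowP => j; rewrite !mxE; field.
- move=> q x [[i0 _ Fx0] nCx] [e e0 he].
  have [U [oU Ux hU]] := isometry_near nCx.
  have [e' /andP[e'0 e'1] he'] := toward_near oU Ux.
  have : \forall y \near x, U y by exact: open_nbhs_nbhs.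
  apply: filterS => y Uy [[i _ Fy] nCy].
  have [e2 /andP[e20 e21] he2] := toward_near oU Uy.
  have [_ Fx _] := hU i y Uy Fy.
  have iso a b : U a -> F i a -> U b -> F i b -> dist2 (f a) (f b) = dist2 a b.
    by move=> Ua Fa Ub Fb; have [_ _] := hU i a Ua Fa; exact.
  exists e2 => // t /andP[t0 te].
  pose s := Num.min e e'.
  have s0 : 0 < s by rewrite lt_min e0.
  have sN : s != 0 by rewrite gt_eqF.
  have [se se'] : s <= e /\ s <= e' by rewrite !ge_min !lexx orbT.
  have Uys : U (toward x s) by apply: he'; rewrite (ltW s0).
  have Fxs : F i (toward x s) by apply: starF => //; rewrite (ltW s0) (le_trans se').
  have Uyt : U (toward y t) by apply: he2; rewrite t0.
  have Fyt : F i (toward y t) by apply: starF => //; rewrite t0 (le_trans te).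
  (* The vector [t (v - y)] is [t (x - y)] plus [t / s] times the step from [x]. The four points lie
     in one face, so [f] preserves this relation and [q] carries over from [x] to [y]. *)
  have := @isometry_affine4 R n p (toward y t) y x (toward x s)
    (f (toward y t)) (f y) (f x) (f (toward x s)) 1 (t - 1) (t / s - t) (- (t / s)).
  rewrite !iso// => /(_ erefl erefl erefl erefl erefl erefl).
  have -> : 1 + (t - 1) + (t / s - t) - t / s = 0 by ring.
  move=> /(_ erefl); rewrite [f (toward x s)]he ?(ltW s0)// => H.
  apply/eqP; rewrite -subr_eq0 -[X in _ == X]H.
    by apply/eqP/rowP => j; rewrite !mxE; field.
  by apply/rowP => j; rewrite !mxE; field.
- move=> q q' x _ [e e0 he] [e' e'0 he'].
  have m0 : 0 < Num.min e e' by rewrite lt_min e0.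
  have : Num.min e e' *: (q - f x) = Num.min e e' *: (q' - f x).
    by apply: (addrI (f x)); rewrite -he ?he'// !ge_min !lexx ?orbT ltW.
  by move=> /(scalerI (lt0r_neq0 m0)) /addIr.
- move=> q hq; exists q => x Px; have [e e0 he] := hq _ Px.
  case: (Px) => -[i _ Fx] nCx.
  have [U [oU Ux hU]] := isometry_near nCx.
  have [e' /andP[e'0 e'1] he'] := toward_near oU Ux.
  pose s := Num.min e e'.
  have s0 : 0 < s by rewrite lt_min e0.
  have [se se'] : s <= e /\ s <= e' by rewrite !ge_min !lexx orbT.
  have Uxs : U (toward x s) by apply: he'; rewrite (ltW s0).
  have Fxs : F i (toward x s) by apply: starF => //; rewrite (ltW s0) (le_trans se').
  (* The step from [x] has length [s |v - x|] and its image has length [s |q - f x|]; the isometry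
     equates them. *)
  have [_ _ /(_ _ Ux Fx)] := hU i _ Uxs Fxs.
  rewrite he ?(ltW s0)// /dist2 /toward !(addrC _ (_ *: _)) !addrK !dotvZl !dotvZr.
  move=> /(mulfI (lt0r_neq0 s0))/(mulfI (lt0r_neq0 s0)).
  by rewrite !dotvE (dotvC (f x) q) (dotvC x v) => H; lra.
Qed.

End ApexImage.

(** * Unit vectors of the plane and vertices of regular polygons *)

Section PlaneDirections.
Variable R : realType.

Definition dir (t : R) : 'rV[R]_2 := \row_j (if j == ord0 then cos t else sin t).

Lemma dotv2E (x y : 'rV[R]_2) :
  dotv x y = x ord0 ord0 * y ord0 ord0 + x ord0 ord_max * y ord0 ord_max.
Proof.
rewrite /dotv big_ord_recl big_ord1.
by rewrite (_ : lift ord0 ord0 = ord_max)//; apply/val_inj.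
Qed.

Lemma rV2P (x y : 'rV[R]_2) : x ord0 ord0 = y ord0 ord0 ->
  x ord0 ord_max = y ord0 ord_max -> x = y.
Proof.
move=> h0 h1; apply/rowP => j; have [->//|j0] := eqVneq j ord0.
by have -> : j = ord_max by apply/val_inj; case: j j0 => -[|[|]].
Qed.

Lemma dirE0 t : dir t ord0 ord0 = cos t. Proof. by rewrite mxE. Qed.
Lemma dirE1 t : dir t ord0 ord_max = sin t. Proof. by rewrite mxE. Qed.

Lemma dotv_dir s t : dotv (dir s) (dir t) = cos (s - t).
Proof. by rewrite dotv2E !dirE0 !dirE1 cosB. Qed.

(** The angle is [acos] of the first coordinate, taken with the sign of the second. *)
Lemma unit_vector_dir (x : 'rV[R]_2) : dotv x x = 1 -> exists t, x = dir t.
Proof.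
rewrite dotv2E; set c := x _ _; set s := x _ _ => cs1.
have c1 : -1 <= c <= 1.
  have s2 : 0 <= s * s by rewrite -expr2 sqr_ge0.
  by rewrite -ler_norml -(@expr_le1 _ 2)// real_normK ?num_real// expr2; lra.
have sE : sin (acos c) = `|s|.
  by rewrite sin_acos// -sqrtr_sqr; congr Num.sqrt; lra.
have [s0|s0] := lerP 0 s.
  exists (acos c); apply: rV2P; rewrite ?dirE0 ?dirE1 -/c -/s.
    by rewrite acosK.
  by rewrite sE ger0_norm.
exists (- acos c); apply: rV2P; rewrite ?dirE0 ?dirE1 -/c -/s.
  by rewrite cosN acosK.
by rewrite sinN sE ltr0_norm// opprK.
Qed.

(** A unit vector orthogonal to [A] is a quarter turn of it in one of two senses, told apart by [s],
    the determinant of [A] and [B]. *)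
Lemma orthonormal_dir (A B : 'rV[R]_2) :
  dotv A A = 1 -> dotv B B = 1 -> dotv A B = 0 ->
  exists a s, (s = 1 \/ s = -1) /\
    forall t, cos t *: A + sin t *: B = dir (a + s * t).
Proof.
move=> /unit_vector_dir[a ->]; rewrite !dotv2E dirE0 dirE1.
set b0 := B _ _; set b1 := B _ _ => b1E ab.
have cs := cos2Dsin2 a.
pose s := b1 * cos a - b0 * sin a.
have b0s : b0 = - s * sin a.
  rewrite /s -[LHS]mulr1 -cs.
  have -> : b0 * (cos a ^+ 2 + sin a ^+ 2) =
    cos a * (cos a * b0 + sin a * b1) - cos a * sin a * b1 + b0 * sin a ^+ 2.
    by ring.
  by rewrite ab; ring.
have b1s : b1 = s * cos a.
  rewrite /s -[LHS]mulr1 -cs.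
  have -> : b1 * (cos a ^+ 2 + sin a ^+ 2) =
    sin a * (cos a * b0 + sin a * b1) - cos a * sin a * b0 + b1 * cos a ^+ 2.
    by ring.
  by rewrite ab; ring.
have s2 : s ^+ 2 = 1.
  rewrite -b1E [in RHS]b0s [in RHS]b1s.
  have -> : - s * sin a * (- s * sin a) + s * cos a * (s * cos a) =
    s ^+ 2 * (cos a ^+ 2 + sin a ^+ 2) by ring.
  by rewrite cs mulr1.
have s1 : s = 1 \/ s = -1.
  by move/eqP: s2; rewrite sqrf_eq1 => /orP[] /eqP; [left|right].
exists a, s; split => // t.
apply: rV2P; rewrite ?dirE0 ?dirE1 !mxE/=.
  rewrite -/b0 b0s cosD.
  by case: s1 => ->; rewrite ?mul1r ?mulN1r ?cosN ?sinN; ring.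
rewrite -/b1 b1s sinD.
by case: s1 => ->; rewrite ?mul1r ?mulN1r ?cosN ?sinN; ring.
Qed.

Lemma dir_periodz t (m : int) : dir (t + m%:~R * (2 * pi)) = dir t.
Proof.
have Hn (u : R) n : dir (u + n%:R * (2 * pi)) = dir u.
  have -> : n%:R * (2 * pi) = pi *+ 2 *+ n :> R.
    by rewrite !mulr_natl.
  apply: rV2P; rewrite ?dirE0 ?dirE1.
    by rewrite (periodicn (@cosD2pi R)).
  by rewrite (periodicn (@sinD2pi R)).
case: m => n; first exact: Hn.
by rewrite NegzE mulrNz mulNr -[in RHS](subrK (n.+1%:R * (2 * pi)) t) Hn.
Qed.

(** The angle [b + s * t] sweeps a half-open interval of length [2 * pi / N], which contains a
    multiple of that length in either direction of travel. *)
Lemma arc_hits_root N (a b s : R) : (0 < N)%N -> s = 1 \/ s = -1 ->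
  exists t, a <= t < a + 2 * pi / N%:R /\
    exists n : 'I_N, dir (b + s * t) = dir (2 * pi / N%:R * n%:R).
Proof.
move=> N0 s1; set d := 2 * pi / N%:R.
have d0 : 0 < d by rewrite divr_gt0 ?mulr_gt0 ?pi_gt0 ?ltr0n.
have [t [z [tI tz]]] : exists t (z : int),
    a <= t < a + d /\ b + s * t = d * z%:~R.
  (* Rounding up for [s = 1] and down for [s = -1] puts [t] in an interval closed on the left and
     open on the right. *)
  case: s1 => ->.
    have /andP[] := ceil_itv ((b + a) / d); set z := Num.ceil _.
    rewrite intrB -[X in _ < X]/((b + a) / d) ltr_pdivlMr// ler_pdivrMr// => h1 h2.
    by exists (z%:~R * d - b), z; split; [apply/andP; split; lra|ring].
  have /andP[] := floor_itv ((b - a) / d); set z := Num.floor _.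
  rewrite intrD ler_pdivlMr// ltr_pdivrMr// => h1 h2.
  by exists (b - z%:~R * d), z; split; [apply/andP; split; lra|ring].
exists t; split => //.
(* Whole turns are removed by reducing [z] modulo [N]. *)
have Nz : N%:Z != 0 by rewrite -lt0n.
have z0 : 0 <= (z %% N)%Z by rewrite modz_ge0.
have zN : (`|(z %% N)%Z| < N)%N.
  by rewrite -ltz_nat gez0_abs// ltz_pmod.
exists (Ordinal zN) => /=.
rewrite tz {1}(divz_eq z N) -[in RHS](dir_periodz _ (z %/ N)%Z); congr dir.
rewrite -{1}(gez0_abs z0) intrD intrM mulrDr addrC; congr (_ + _).
have NR : N%:R != 0 :> R by rewrite pnatr_eq0 -lt0n.
by rewrite /d -[(N : int)%:~R]/(N%:R); field.
Qed.

End PlaneDirections.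

(** * Unit-speed motion on the unit circle *)

Section UnitArcs.
Variable R : realType.
Implicit Types (G : R -> 'rV[R]_2).

(* [G] moves at unit speed along the unit circle, as seen on [D]. *)
Definition unit_speed_on (D : set R) G := forall t, D t ->
  exists U : set R, [/\ open U, U t & forall s s', U s -> D s -> U s' -> D s' ->
    dotv (G s) (G s') = cos (s - s')].

Lemma unit_speed_sub (D D' : set R) G : D' `<=` D ->
  unit_speed_on D G -> unit_speed_on D' G.
Proof.
move=> sub h t /sub /h[U [oU Ut hU]]; exists U; split => // s s' Us Ds Us' Ds'.
by apply: hU => //; exact: sub.
Qed.

(** Provides a second time near [t], with [sin (t' - t)] as the nonzero determinant of [dir t] and
    [dir t']. *)
Lemma right_neighbour (U : set R) a b t : open U -> U t -> a <= t < b ->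
  exists t', [/\ U t', a <= t' < b & 0 < sin (t' - t)].
Proof.
move=> oU Ut /andP[at_ tb].
have /nbhs_ballP[e /= e0 he] : nbhs t U by exact: open_nbhs_nbhs.
pose h := Num.min (Num.min (e / 2) 1) ((b - t) / 2).
have h0 : 0 < h by rewrite !lt_min ltr01 !divr_gt0 ?subr_gt0.
have [h1 h2 h3] : [/\ h <= e / 2, h <= 1 & h <= (b - t) / 2].
  by rewrite !ge_min !lexx !orbT.
exists (t + h); split.
- by apply: he; rewrite /ball/= opprD addNKr normrN gtr0_norm//; lra.
- by apply/andP; split; lra.
- by rewrite addrAC subrr add0r sin_gt0_pi// h0/=; have := @pi_ge2 R; lra.
Qed.

(** Near each time, two values of [G] determine an orthonormal pair [(A, B)]; this pair is locally
    constant on an interval, hence constant. *)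
Lemma unit_speed_rotation a b G :
  a < b -> unit_speed_on [set t | a <= t < b] G ->
  exists A B, [/\ dotv A A = 1, dotv B B = 1, dotv A B = 0 &
    forall t, a <= t < b -> G t = cos t *: A + sin t *: B].
Proof.
move=> ab h; set D := [set t | a <= t < b].
pose Q (AB : 'rV[R]_2 * 'rV[R]_2) t :=
  [/\ dotv AB.1 AB.1 = 1, dotv AB.2 AB.2 = 1, dotv AB.1 AB.2 = 0 &
   exists U : set R, [/\ open U, U t & forall s, U s -> D s ->
     G s = cos s *: AB.1 + sin s *: AB.2]].
have Dc : connected D.
  apply/connected_intervalP => x y /andP[ax xb] /andP[ay yb] z /andP[xz zy].
  by apply/andP; split; [exact: le_trans xz|exact: le_lt_trans yb].
have [] := @connected_locally_constant _ _ D Q Dc (inhabits (0, 0)).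
- move=> t Dt; have [U [oU Ut hU]] := h t Dt.
  have [t' [Ut' Dt' d0]] := right_neighbour oU Ut Dt.
  have dN : sin (t' - t) != 0 by rewrite gt_eqF.
  pose d := sin (t' - t); rewrite -/d in d0 dN.
  have dE : d = sin t' * cos t - cos t' * sin t by rewrite /d sinB.
  have c1 := cos2Dsin2 t; have c2 := cos2Dsin2 t'.
  have Gtt : dotv (G t) (G t) = 1 by rewrite hU// subrr cos0.
  have Gtt' : dotv (G t') (G t') = 1 by rewrite hU// subrr cos0.
  have Gt't : dotv (G t') (G t) = cos t' * cos t + sin t' * sin t.
    by rewrite hU// cosB.
  have scale x y z : z = x * y * d ^+ 2 -> d^-1 * (d^-1 * z) = x * y.
    by move=> ->; field.
  (* Cramer's rule for the two equations at [t] and [t'], of determinant [d]. *)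
  exists (d^-1 *: (sin t' *: G t - sin t *: G t'),
          d^-1 *: (cos t *: G t' - cos t' *: G t)).
  split => /=.
  + rewrite !dotvZl !dotvZr (scale 1 1) ?mulr1// !dotvE (dotvC (G t)) Gtt Gtt' Gt't dE.
    apply/eqP; rewrite -subr_eq0; apply/eqP.
    transitivity (sin t' ^+ 2 * (1 - (cos t ^+ 2 + sin t ^+ 2))
      + sin t ^+ 2 * (1 - (cos t' ^+ 2 + sin t' ^+ 2))); first by ring.
    by rewrite c1 c2; ring.
  + rewrite !dotvZl !dotvZr (scale 1 1) ?mulr1// !dotvE (dotvC (G t)) Gtt Gtt' Gt't dE.
    apply/eqP; rewrite -subr_eq0; apply/eqP.
    transitivity (cos t' ^+ 2 * (1 - (cos t ^+ 2 + sin t ^+ 2))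
      + cos t ^+ 2 * (1 - (cos t' ^+ 2 + sin t' ^+ 2))); first by ring.
    by rewrite c1 c2; ring.
  + rewrite !dotvZl !dotvZr (scale 0 0) ?mulr0// !dotvE (dotvC (G t)) Gtt Gtt' Gt't.
    transitivity (- (sin t' * cos t') * (1 - (cos t ^+ 2 + sin t ^+ 2))
      - sin t * cos t * (1 - (cos t' ^+ 2 + sin t' ^+ 2))); first by ring.
    by rewrite c1 c2; ring.
  exists U; split => // s Us Ds.
  have iso r r' : U r -> D r -> U r' -> D r' ->
      dist2 (G r) (G r') = dist2 (dir r) (dir r').
    move=> Ur Dr Ur' Dr'; rewrite /dist2 !dotvE !dotv_dir !hU//.
  have iso0 r : U r -> D r -> dist2 (G r) 0 = dist2 (dir r) 0.
    by move=> Ur Dr; rewrite /dist2 !subr0 hU// dotv_dir.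
  (* The first three weights express [dir s] through [dir t] and [dir t']; the origin, matched with
     itself, takes the weight that makes the sum zero. Equal distances transfer the relation to
     [G]. *)
  have := @isometry_affine4 R 2 2 (dir s) (dir t) (dir t') 0 (G s) (G t) (G t') 0
    d (- sin (t' - s)) (- sin (s - t)) (sin (t' - s) + sin (s - t) - d).
  rewrite !iso// !iso0// => /(_ erefl erefl erefl erefl erefl erefl).
  have -> : d - sin (t' - s) - sin (s - t) + (sin (t' - s) + sin (s - t) - d) = 0.
    by ring.
  move=> /(_ erefl) Hs; apply: (scalerI dN).
  apply/eqP; rewrite -subr_eq0 -[X in _ == X]Hs.
    by apply/eqP/rowP => j; rewrite !mxE !sinB; field.
  apply: rV2P; rewrite !mxE/= /d !sinB; ring.
- move=> AB t Dt [AA BB AB0 [U [oU Ut hU]]].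
  have : \forall y \near t, U y by exact: open_nbhs_nbhs.
  by apply: filterS => y Uy Dy; split => //; exists U.
(* Two pairs valid near [t] both hold at [t] and [t'], so their difference solves a homogeneous
   system of determinant [sin (t' - t)]. *)
- move=> [A B] [A' B'] t Dt [/= _ _ _ [U [oU Ut hU]]] [/= _ _ _ [V [oV Vt hV]]].
  have [t' [[Ut' Vt'] Dt' d0]] := right_neighbour (openI oU oV) (conj Ut Vt) Dt.
  have e1 : cos t *: (A - A') + sin t *: (B - B') = 0.
    by rewrite !scalerBr addrACA -opprD -hU// -hV// subrr.
  have e2 : cos t' *: (A - A') + sin t' *: (B - B') = 0.
    by rewrite !scalerBr addrACA -opprD -hU// -hV// subrr.
  have eA : sin (t' - t) *: (A - A') = 0.
    transitivity (sin t' *: (cos t *: (A - A') + sin t *: (B - B'))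
                - sin t *: (cos t' *: (A - A') + sin t' *: (B - B'))).
      by rewrite sinB; apply/rowP => j; rewrite !mxE; ring.
    by rewrite e1 e2 !scaler0 subr0.
  have eB : sin (t' - t) *: (B - B') = 0.
    transitivity (cos t *: (cos t' *: (A - A') + sin t' *: (B - B'))
                - cos t' *: (cos t *: (A - A') + sin t *: (B - B'))).
      by rewrite sinB; apply/rowP => j; rewrite !mxE; ring.
    by rewrite e1 e2 !scaler0 subr0.
  move/eqP: eA; move/eqP: eB; rewrite !scaler_eq0 gt_eqF//= !subr_eq0.
  by move=> /eqP-> /eqP->.
- move=> [A B] hAB; exists A, B.
  have Da : D a by rewrite /D/= lexx.
  have [AA BB AB _] := hAB a Da; split => //.
  by move=> t Dt; have [_ _ _ [U [_ Ut ->]]] := hAB t Dt.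
Qed.

(** Time is cut into cells of length [2 * pi / N]. A full cell free of [0] and of [S] yields a
    vertex of the [N]-gon, different cells yielding different vertices. The summand 2 pays for the
    cell of [0] and the last, incomplete cell. *)
Lemma card_roots_on_arcs (N : nat) (theta : R) (S : seq R) G :
  let D := [set t | 0 < t < theta /\ t \notin S] in
  (0 < N)%N -> unit_speed_on D G ->
  (forall s t : R, D s -> D t -> G s = G t -> s = t) ->
  theta * N%:R / (2 * pi) <=
    (#|[set n : 'I_N | `[< exists2 t : R, D t & G t = dir (2 * pi / N%:R * n%:R) >]]%SET|
     + size S + 2)%:R.
Proof.
move=> D N0 hG Ginj; set roots := (X in #|pred_of_set X|).
set d : R := 2 * pi / N%:R.
have NR : 0 < N%:R :> R by rewrite ltr0n.
have d0 : 0 < d by rewrite divr_gt0 ?mulr_gt0 ?pi_gt0.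
have -> : theta * N%:R / (2 * pi) = theta / d.
  by rewrite /d invf_div mulrA.
pose K := Num.truncn (theta / d).
pose bad := [seq Num.truncn (s / d) | s <- 0 :: S].
pose good := [set m : 'I_K | val m \notin bad]%SET.
have cell (m : 'I_K) t : m%:R * d <= t < m%:R * d + d -> Num.truncn (t / d) = m.
  move=> /andP[mt tm]; apply: truncn_def.
  rewrite ler_pdivlMr// mt ltr_pdivrMr//= -natr1; lra.
have cellD (m : 'I_K) : m \in good -> [set t | m%:R * d <= t < m%:R * d + d] `<=` D.
  rewrite inE => mbad t mt.
  have tbad : t \notin 0 :: S.
    by apply: contra mbad => tS; rewrite -[val m](cell m t mt);
      exact: (map_f (fun s => Num.truncn (s / d)) tS).
  move: tbad mt; rewrite inE negb_or => /andP[tN tS] /andP[mt tm]; split => //.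
  have md0 : 0 <= m%:R * d by apply: mulr_ge0 => //; exact: ltW.
  rewrite lt_def tN (le_trans md0 mt)/=.
  have : m.+1%:R <= theta / d by rewrite -truncn_gt_nat ltn_ord.
  by rewrite ler_pdivlMr// -natr1; lra.
(* [choice] needs a value for every cell, hence an idle pair for the bad ones. *)
have hit : forall m : 'I_K, exists nt : 'I_N * R, m \in good ->
    [/\ D nt.2, G nt.2 = dir (d * nt.1%:R) & Num.truncn (nt.2 / d) = m].
  move=> m; have [mg|mg] := boolP (m \in good); last by exists (Ordinal N0, 0).
  have md : m%:R * d < m%:R * d + d by rewrite ltrDl.
  have [A [B [AA BB AB0 GE]]] :=
    unit_speed_rotation md (unit_speed_sub (cellD m mg) hG).
  have [b [s [s1 E]]] := orthonormal_dir AA BB AB0.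
  have [t [tI [n nE]]] := arc_hits_root (m%:R * d) b N0 s1.
  exists (n, t) => _; split; [exact: cellD tI|by rewrite GE// E nE|exact: cell].
have [h hh] := choice hit.
(* By injectivity of [G] the vertex determines the time, and the time determines its cell. *)
have cardg : (#|good| <= #|roots|)%N.
  rewrite -(@card_in_imset _ _ (fun m => (h m).1) good); last first.
    move=> m m' mg mg' /= e; apply/val_inj => /=.
    have [Dm Gm <-] := hh m mg; have [Dm' Gm' <-] := hh m' mg'.
    by rewrite (Ginj _ _ Dm Dm')// Gm Gm' e.
  apply/subset_leq_card/fintype.subsetP => _ /imsetP[m mg ->].
  rewrite inE; apply/asboolP; have [Dm Gm _] := hh m mg.
  by exists (h m).2.
have cardb : (#|~: good| <= size S + 1)%N.
  rewrite -(size_map (fun s => Num.truncn (s / d)) S) addn1.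
  rewrite -[(size _).+1]/(size bad) cardE -(size_map val).
  apply: uniq_leq_size; first by rewrite (map_inj_uniq val_inj) enum_uniq.
  by move=> _ /mapP[m + ->]; rewrite mem_enum !inE negbK.
have := cardsC good; rewrite card_ord => KE.
have : theta / d < K.+1%:R by exact: truncnS_gt.
move=> /ltW /le_trans; apply; rewrite ler_nat -KE; lia.
Qed.

End UnitArcs.

(** * Circular arcs in the sector of two independent vectors *)

Section Slerp.
Variables (R : realType) (n : nat) (a b : 'rV[R]_n).
Hypothesis ab_free : forall x y : R, x *: a + y *: b = 0 -> x = 0 /\ y = 0.

Let na := Num.sqrt (dotv a a).
Let nb := Num.sqrt (dotv b b).
Let theta := acos (dotv a b / (na * nb)).

Lemma free_pair_norm_gt0 : 0 < na /\ 0 < nb.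
Proof.
rewrite !sqrtr_gt0 !lt_def !dotv_ge0 !dotv_eq0 !andbT.
split; apply/eqP => x0.
  have [] := @ab_free 1 0; first by rewrite x0 scaler0 scale0r addr0.
  by move=> /eqP; rewrite oner_eq0.
have [] := @ab_free 0 1; first by rewrite x0 scaler0 scale0r addr0.
by move=> _ /eqP; rewrite oner_eq0.
Qed.

Let na0 : 0 < na. Proof. exact: free_pair_norm_gt0.1. Qed.
Let nb0 : 0 < nb. Proof. exact: free_pair_norm_gt0.2. Qed.
Let na2 : dotv a a = na ^+ 2. Proof. by rewrite sqr_sqrtr ?dotv_ge0. Qed.
Let nb2 : dotv b b = nb ^+ 2. Proof. by rewrite sqr_sqrtr ?dotv_ge0. Qed.

(** Strict Cauchy-Schwarz: by independence [nb *: a + na *: b] and [nb *: a - na *: b] are nonzero,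
    so their squared norms are positive. *)
Lemma free_pair_cos : -1 < dotv a b / (na * nb) < 1.
Proof.
have nab : 0 < na * nb by rewrite mulr_gt0.
have pos (s : R) : s ^+ 2 = 1 -> 0 < na * nb + s * dotv a b.
  move=> s2; have : 0 < dotv (nb *: a + (s * na) *: b) (nb *: a + (s * na) *: b).
    rewrite lt_def dotv_ge0 dotv_eq0 andbT; apply/eqP => /ab_free[/eqP].
    by rewrite gt_eqF.
  rewrite !dotvE (dotvC b a) na2 nb2.
  set L := (X in 0 < X).
  have -> : L = (na * nb) * (na * nb * (1 + s ^+ 2) + 2 * (s * dotv a b)).
    by rewrite /L; ring.
  by rewrite s2 pmulr_rgt0//; lra.
have := pos 1 (expr1n _ _); have := pos (-1) (sqrr_sign _ 1).
by rewrite ltr_pdivlMr// ltr_pdivrMr// => h1 h2; apply/andP; split; lra.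
Qed.

Lemma free_pair_angle : 0 < theta < pi.
Proof.
have /andP[h1 h2] := free_pair_cos.
by rewrite acos_gt0 ?acos_ltpi// ?h1 ?h2 ltW.
Qed.

Let sin_theta : 0 < sin theta. Proof. exact: sin_gt0_pi free_pair_angle. Qed.

Let cos_theta : cos theta = dotv a b / (na * nb).
Proof. by have /andP[h1 h2] := free_pair_cos; rewrite acosK// in_itv/= !ltW. Qed.

(* The unit vector at angle [t] from [a], in the sector spanned by [a], [b]. *)
Definition slerp (t : R) : 'rV[R]_n :=
  (sin (theta - t) / (sin theta * na)) *: a + (sin t / (sin theta * nb)) *: b.

(** With [dotv a b] written as [cos theta * (na * nb)] the lengths cancel, and what remains follows
    from the Pythagorean identity for [theta]. *)
Lemma dotv_slerp s t : dotv (slerp s) (slerp t) = cos (s - t).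
Proof.
have [aN bN sN] : [/\ na != 0, nb != 0 & sin theta != 0] by rewrite !gt_eqF.
rewrite /slerp !dotvE (dotvC b a) na2 nb2.
have -> : dotv a b = cos theta * (na * nb) by rewrite cos_theta; field; apply/andP.
have -> : cos (s - t) = (sin theta) ^- 2 * ((sin theta) ^+ 2 * cos (s - t)).
  by field.
move: na nb aN bN => A B A0 B0.
transitivity ((sin theta) ^- 2 * (sin (theta - s) * sin (theta - t) +
  sin s * sin t + cos theta * (sin (theta - s) * sin t + sin s * sin (theta - t)))).
  by field; rewrite ?A0 ?B0 ?sN.
congr (_ * _); rewrite !sinB cosB; apply/eqP; rewrite -subr_eq0; apply/eqP.
transitivity (sin s * sin t * (1 - (cos theta ^+ 2 + sin theta ^+ 2))); first by ring.
by rewrite cos2Dsin2; ring.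
Qed.

Lemma slerp_continuous : continuous slerp.
Proof.
move=> t; apply: cvgD; apply: cvgZr_tmp; apply: cvgM;
  [|exact: cvg_cst|exact: continuous_sin|exact: cvg_cst].
apply: (@continuous_comp _ _ _ (fun s => theta - s) sin); last exact: continuous_sin.
by apply: cvgB; [exact: cvg_cst|exact: cvg_id].
Qed.

(** The coefficients along [a] and [b] are nonnegative as [t] and [theta - t] lie in [[0, pi]];
    bounding their sines by 1 turns the assumption on [r] into a bound on their sum. *)
Lemma slerp_tri (v : 'rV[R]_n) (r t : R) : 0 <= r ->
  r * (na^-1 + nb^-1) <= sin theta -> 0 <= t <= theta ->
  tri v (v + a) (v + b) (v + r *: slerp t).
Proof.
move=> r0 rs /andP[t0 tth]; have /andP[th0 thpi] := free_pair_angle.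
have s1 : 0 <= sin (theta - t) by rewrite sin_ge0_pi//; apply/andP; split; lra.
have s2 : 0 <= sin t by rewrite sin_ge0_pi//; apply/andP; split; lra.
exists (r * (sin (theta - t) / (sin theta * na))), (r * (sin t / (sin theta * nb))).
have sa : 0 < sin theta * na by rewrite mulr_gt0.
have sb : 0 < sin theta * nb by rewrite mulr_gt0.
split.
- by rewrite mulr_ge0// divr_ge0// ltW.
- by rewrite mulr_ge0// divr_ge0// ltW.
- apply: le_trans (_ : r * (na^-1 + nb^-1) / sin theta <= _); last first.
    by rewrite ler_pdivrMr// mul1r.
  rewrite -mulrDr -mulrA ler_wpM2l// mulrDl lerD//.
    rewrite ler_pdivrMr// (_ : _ * (sin theta * na) = 1) ?sin_le1//.
    by field; rewrite !gt_eqF.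
  rewrite ler_pdivrMr// (_ : _ * (sin theta * nb) = 1) ?sin_le1//.
  by field; rewrite !gt_eqF.
- by rewrite ![v + _ - v]addrC !addKr /slerp scalerDr !scalerA addrA.
Qed.

(** Strictly inside the sector both coefficients are positive, while on an edge one of them
    vanishes. *)
Lemma slerp_notin_edges (v : 'rV[R]_n) (r t : R) : 0 < r -> 0 < t < theta ->
  ~ seg v (v + a) (v + r *: slerp t) /\ ~ seg v (v + b) (v + r *: slerp t).
Proof.
move=> r0 /andP[t0 tth]; have /andP[th0 thpi] := free_pair_angle.
have s1 : 0 < sin (theta - t) by rewrite sin_gt0_pi//; apply/andP; split; lra.
have s2 : 0 < sin t by rewrite sin_gt0_pi//; apply/andP; split; lra.
have c1 : 0 < r * (sin (theta - t) / (sin theta * na)).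
  by rewrite mulr_gt0// divr_gt0// mulr_gt0.
have c2 : 0 < r * (sin t / (sin theta * nb)).
  by rewrite mulr_gt0// divr_gt0// mulr_gt0.
split=> -[u [_]]; rewrite [v + _ - v]addrC addKr => /addrI;
  rewrite /slerp scalerDr !scalerA => /eqP; rewrite -subr_eq0.
  rewrite addrAC -scalerBl => /eqP/ab_free[_ H].
  by rewrite H ltxx in c2.
by rewrite -addrA -scalerBl => /eqP/ab_free[H _]; rewrite H ltxx in c1.
Qed.

End Slerp.

(** * Segments against spheres, and finite counting *)

(** The squared distance to [v] is quadratic in the parameter, with leading coefficient [dotv d d].
    Three distinct parameters of equal value force [d = 0], and then the segment is a point. *)
Lemma seg_meets_sphere_twice (R : realType) n (a b v x1 x2 x3 : 'rV[R]_n) (c : R) :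
  seg a b x1 -> seg a b x2 -> seg a b x3 ->
  dist2 x1 v = c -> dist2 x2 v = c -> dist2 x3 v = c ->
  [\/ x1 = x2, x1 = x3 | x2 = x3].
Proof.
move=> [t1 [_ ->]] [t2 [_ ->]] [t3 [_ ->]].
set d := b - a; set u := a - v.
have E t : dist2 (a + t *: d) v =
    dotv u u + 2 * t * dotv u d + t ^+ 2 * dotv d d.
  by rewrite /dist2 addrAC -/u -/d; move: u d => u d; rewrite !dotvE (dotvC d u); ring.
rewrite !E => e1 e2 e3.
have [t12|t12] := eqVneq t1 t2; first by rewrite t12; constructor 1.
have [t13|t13] := eqVneq t1 t3; first by rewrite t13; constructor 2.
have [t23|t23] := eqVneq t2 t3; first by rewrite t23; constructor 3.
(* A divided difference of the quadratic; subtracting two of them isolates the leading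
   coefficient. *)
have H (s t : R) : s != t -> dotv u u + 2 * s * dotv u d + s ^+ 2 * dotv d d = c ->
    dotv u u + 2 * t * dotv u d + t ^+ 2 * dotv d d = c ->
    2 * dotv u d + (s + t) * dotv d d = 0.
  move=> st es et; have st0 : s - t != 0 by rewrite subr_eq0.
  apply: (mulfI st0); rewrite mulr0 -[RHS](subrr c) -{1}es -et; ring.
have h1 := H _ _ t12 e1 e2; have h2 := H _ _ t13 e1 e3.
have : (t2 - t3) * dotv d d = 0.
  by rewrite -[RHS](subrr 0) -{1}h1 -h2; ring.
move/eqP; rewrite mulf_eq0 subr_eq0 (negPf t23) dotv_eq0 => /eqP ->.
by rewrite !scaler0; constructor 1.
Qed.

Lemma at_most_two_values (T : Type) (t0 : T) (P : T -> Prop) :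
  (forall x y z, P x -> P y -> P z -> [\/ x = y, x = z | y = z]) ->
  exists p : T * T, forall x, P x -> x = p.1 \/ x = p.2.
Proof.
move=> h; have [[x Px]|nP] := pselect (exists x, P x); last first.
  by exists (t0, t0) => x Px; case: nP; exists x.
have [[y [Py xy]]|nP] := pselect (exists y, P y /\ x <> y); last first.
  exists (x, x) => z Pz; left; apply: contrapT => zx; apply: nP.
  by exists z; split => // xz; apply: zx.
exists (x, y) => z Pz; have [//|xz|yz] := h _ _ _ Px Py Pz.
- by left.
- by right.
Qed.

(** Double counting: after exchanging the sums, each [x] contributes at most one. *)
Lemma sum_card_disjoint (I T : finType) (A : I -> {set T}) :
  (forall i j x, x \in A i -> x \in A j -> i = j) ->
  (\sum_i #|A i| <= #|T|)%N.
Proof.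
move=> disj; under eq_bigr do rewrite -sum1_card big_mkcond.
rewrite exchange_big/= -sum1_card leq_sum// => x _.
have [/existsP[i xi]|/existsPn nx] := boolP [exists i, x \in A i]; last first.
  by rewrite big1// => i _; rewrite (negPf (nx i)).
rewrite (bigD1 i)//= xi big1// => j ji; case: ifP => // xj.
by rewrite (disj _ _ _ xi xj) eqxx in ji.
Qed.

(** The inverse of one plus the sum of all inverses lies below each [m i], and stays positive for
    empty [I]. *)
Lemma small_radius (R : realFieldType) (I : finType) (m : I -> R) :
  (forall i, 0 < m i) -> exists2 r : R, 0 < r & forall i, r <= m i.
Proof.
move=> m0; have s0 : 0 <= \sum_i (m i)^-1.
  by apply: sumr_ge0 => i _; rewrite invr_ge0 ltW.
exists (1 + \sum_i (m i)^-1)^-1; first by rewrite invr_gt0 ltr_pwDl.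
move=> i; rewrite -[leRHS]invrK lef_pV2 ?posrE ?invr_gt0 ?ltr_pwDl//.
rewrite (bigD1 i)//= addrCA lerDl addr_ge0//.
by apply: sumr_ge0 => j _; rewrite invr_ge0 ltW.
Qed.

(** * The small circle about [v] on the fan *)

Section Unfolding.
Variables (R : realType) (k : nat) (v : 'rV[R]_3) (w : 'I_k -> 'rV[R]_3).
Hypothesis fanP : is_fan_polyhedron v w.

Let edge i := w i - v.
Let theta i := angle_at v (w i) (w (ordS i)).

Lemma fan_edges_free i (x y : R) :
  x *: edge i + y *: edge (ordS i) = 0 -> x = 0 /\ y = 0.
Proof.
case: fanP => /(_ i) rk _ _ _ xy0.
have fr : row_free (col_mx (w i - v) (w (ordS i) - v)) by rewrite /row_free rk.
have : row_mx x%:M y%:M *m col_mx (w i - v) (w (ordS i) - v) =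
    0 *m col_mx (w i - v) (w (ordS i) - v).
  by rewrite mul_row_col !mul_scalar_mx mul0mx.
move/(row_free_inj fr); rewrite -row_mx0 => /eq_row_mx[/matrixP/(_ 0 0) hx].
by move=> /matrixP/(_ 0 0); move: hx; rewrite !mxE.
Qed.

(** For small [r], the part in face [i] of the circle of radius [r] about [v], parametrized by the
    angle from the edge to [w i]. *)
Let arc r i t := v + r *: slerp (edge i) (edge (ordS i)) t.

Lemma theta_bounds i : 0 < theta i < pi.
Proof. exact: (free_pair_angle (@fan_edges_free i)). Qed.

Lemma dist2_arc_center r i t : dist2 (arc r i t) v = r ^+ 2.
Proof.
rewrite /dist2 /arc addrC addKr dotvZl dotvZr. rewrite (dotv_slerp (@fan_edges_free i)).
by rewrite subrr cos0; ring.
Qed.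

Lemma dist2_arc r i s t :
  dist2 (arc r i s) (arc r i t) = r ^+ 2 * (2 - 2 * cos (s - t)).
Proof.
have sl x y := dotv_slerp (@fan_edges_free i) x y.
rewrite /dist2 /arc opprD addrACA subrr add0r -scalerBr dotvZl dotvZr.
have := sl s s; have := sl s t; have := sl t t.
move: (slerp _ _ s) (slerp _ _ t) => x y.
by rewrite !subrr cos0 !dotvE (dotvC y x) => -> -> ->; ring.
Qed.

Lemma arc_continuous r i : continuous (arc r i).
Proof.
move=> t; apply: cvgD; first exact: cvg_cst.
by apply: cvgZl_tmp; exact: slerp_continuous.
Qed.

(** Equal points give [cos (s - t) = 1], and [cos] is injective on [[0, pi]], where [|s - t|]
    lies. *)
Lemma arc_inj r i s t : 0 < r -> 0 < s < theta i -> 0 < t < theta i ->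
  arc r i s = arc r i t -> s = t.
Proof.
move=> r0 /andP[s0 s1] /andP[t0 t1] st; have /andP[_ th] := theta_bounds i.
have : dist2 (arc r i s) (arc r i t) = 0 by rewrite st dist2xx.
rewrite dist2_arc => /eqP; rewrite mulf_eq0 expf_eq0/= gt_eqF//= => /eqP c.
have c1 : cos `|s - t| = cos 0 by rewrite cos_norm cos0; lra.
apply/eqP; rewrite -subr_eq0 -normr_eq0; apply/eqP; apply: cos_inj c1.
  rewrite in_itv/= normr_ge0 ler_norml; apply/andP; split; lra.
by rewrite in_itv/= lexx pi_ge0.
Qed.

(** By [slerp_tri], face [i] admits every radius up to [sin (theta i) / c i]; finitely many faces
    have a common one. *)
Lemma small_arcs_in_faces : exists2 r : R, 0 < r &
  forall i t, 0 < t < theta i -> fan_face v w i (arc r i t).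
Proof.
pose c i := (Num.sqrt (dotv (edge i) (edge i)))^-1 +
  (Num.sqrt (dotv (edge (ordS i)) (edge (ordS i))))^-1.
have c0 i : 0 < c i.
  have [h1 h2] := free_pair_norm_gt0 (@fan_edges_free i).
  by rewrite addr_gt0 ?invr_gt0.
have [|r r0 hr] := @small_radius R 'I_k (fun i => sin (theta i) / c i).
  by move=> i; rewrite divr_gt0// sin_gt0_pi// theta_bounds.
exists r => // i t /andP[t0 t1].
have := @slerp_tri _ _ _ _ (@fan_edges_free i) v r t (ltW r0).
rewrite ![v + (_ - v)]addrC !subrK; apply; last by rewrite !ltW.
by rewrite -ler_pdivlMr; [exact: hr|exact: c0].
Qed.

(** Distinct faces meet in a common edge or only in [v], and an interior arc point lies on neither
    edge of its face at [v], hence is not [v] either. *)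
Lemma arcs_disjoint r i j s t : 0 < r ->
  (forall i t, 0 < t < theta i -> fan_face v w i (arc r i t)) ->
  0 < s < theta i -> 0 < t < theta j -> arc r i s = arc r j t -> i = j.
Proof.
move=> r0 inF si tj st; apply: contrapT => /eqP ij.
have Fi := inF i s si; have Fj := inF j t tj.
have [] := slerp_notin_edges (@fan_edges_free i) v r0 si.
have [] := slerp_notin_edges (@fan_edges_free j) v r0 tj.
rewrite ![v + (_ - v)]addrC !subrK -/(arc r i s) -/(arc r j t) => nj nj' ni ni'.
case: fanP => _ _ adj nadj.
have [jS|jS] := eqVneq j (ordS i).
  by apply: ni'; rewrite -adj -jS; split => //; rewrite st.
have [iS|iS] := eqVneq i (ordS j).
  by apply: nj'; rewrite -adj -iS; split => //; rewrite -st.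
have : (fan_face v w i `&` fan_face v w j) (arc r i s) by split; rewrite // st.
rewrite nadj// => vE; apply: ni; rewrite vE.
by exists 0; rewrite lexx ler01 scale0r addr0.
Qed.

Lemma arc_meets_segments r m (a b : 'I_m -> 'rV[R]_3) i : 0 < r ->
  exists S : seq R, size S = (m + m)%N /\ forall t, 0 < t < theta i ->
    (\bigcup_(j in [set: 'I_m]) seg (a j) (b j)) (arc r i t) -> t \in S.
Proof.
move=> r0.
have two (j : 'I_m) : exists p : R * R, forall t,
    0 < t < theta i /\ seg (a j) (b j) (arc r i t) -> t = p.1 \/ t = p.2.
  apply: (at_most_two_values 0) => x y z [xi xs] [yi ys] [zi zs].
  have [] := seg_meets_sphere_twice xs ys zs (dist2_arc_center r i x)
    (dist2_arc_center r i y) (dist2_arc_center r i z).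
  - by move=> /(arc_inj r0 xi yi); constructor 1.
  - by move=> /(arc_inj r0 xi zi); constructor 2.
  - by move=> /(arc_inj r0 yi zi); constructor 3.
have [p hp] := choice two.
exists ([seq (p j).1 | j <- enum 'I_m] ++ [seq (p j).2 | j <- enum 'I_m]).
split; first by rewrite size_cat !(size_map _ (enum 'I_m)) !size_enum_ord.
move=> t ti [j _ tj]; rewrite mem_cat; apply/orP.
have [->|->] := hp j t (conj ti tj); [left|right].
  by apply/mapP; exists j; rewrite ?mem_enum.
by apply/mapP; exists j; rewrite ?mem_enum.
Qed.

End Unfolding.

Theorem theorem11 (R : realType) (k : nat) (hk : (3 <= k)%N)
    (v : 'rV[R]_3) (w : 'I_k -> 'rV[R]_3) :
  is_fan_polyhedron v w ->
  fan_curvature v w < 0 ->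
  ~ has_general_unfolding v w.
Proof.
move=> fanP curv [C [[[m [a [b [_ CE]]]] _ Pc] [f [finj _ fiso]]]].
have closedC : closed C.
  rewrite CE; apply: closed_bigcup => [|j _]; first exact: finite_finset.
  by rewrite segE; exact: closed_tri.
have closedF i : closed (fan_face v w i) by exact: closed_tri.
have starF i x t : 0 <= t <= 1 -> fan_face v w i x ->
    fan_face v w i (x + t *: (v - x)) by exact: tri_star.
have isoF i x : (fan_face v w i `\` C) x ->
  exists2 e : R, 0 < e & forall y z, (fan_face v w i `\` C) y ->
    (fan_face v w i `\` C) z ->
    dist2 y x < e -> dist2 z x < e -> dist2 (f y) (f z) = dist2 y z.
  by apply: fiso; apply: map_f; rewrite mem_enum.
(* The point [q] stands for the image of [v], even when [v] lies in [C]. *)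
have [q hq] := apex_image closedF starF closedC isoF Pc.
pose theta i := angle_at v (w i) (w (ordS i)).
have [r r0 inF] := small_arcs_in_faces fanP.
pose arc i t := v + r *: slerp (w i - v) (w (ordS i) - v) t.
have [S hS] := choice (fun i => arc_meets_segments fanP a b i r0).
(* Dropping the finite list [S i] leaves only parameters whose points avoid [C]. *)
pose D i := [set t : R | 0 < t < theta i /\ t \notin S i].
have arcP i t : D i t -> (fan_face v w i `\` C) (arc i t).
  move=> [ti tS]; split; first exact: inF.
  by rewrite CE => /(hS i).2; move=> /(_ ti); exact/negP.
have arcPP i t : D i t -> (fan v w `\` C) (arc i t).
  by move=> /arcP[Fi nC]; split => //; exists i.
(* Recentred at [q] and rescaled, the image of the arc lies on the unit circle. *)
pose G i t := r^-1 *: (f (arc i t) - q).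
have rN : r != 0 by rewrite gt_eqF.
have Ginj i j s t : D i s -> D j t -> G i s = G j t -> arc i s = arc j t.
  move=> Ds Dt /(scalerI _) /addIr; rewrite invr_eq0 => /(_ rN).
  by apply: finj; apply: mem_set; exact: arcPP.
have Gspeed i : unit_speed_on (D i) (G i).
  move=> t Dt; have [Ft nCt] := arcP i t Dt.
  have [U [oU Ut hU]] := isometry_near closedF closedC isoF nCt.
  exists (arc i @^-1` U); split => //.
    by apply: open_comp => // s _; exact: (@arc_continuous _ _ _ _ r i).
  move=> s s' Us Ds Us' Ds'.
  have [_ _ /(_ _ Us' (arcP _ _ Ds').1)] := hU i _ Us (arcP _ _ Ds).1.
  rewrite (dist2_arc fanP).
  have := hq _ (arcPP _ _ Ds); have := hq _ (arcPP _ _ Ds').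
  rewrite !(dist2_arc_center fanP) /G dotvZl dotvZr.
  move: (f (arc i s)) (f (arc i s')) => y y'.
  (* Law of cosines at [q]: two sides have length [r] and the isometry fixes the third, hence the
     angle. *)
  rewrite (_ : dist2 y y' = dist2 y q + dist2 y' q - 2 * dotv (y - q) (y' - q)).
    move=> -> -> H.
    have -> : dotv (y - q) (y' - q) = r ^+ 2 * cos (s - s') by lra.
    by field.
  have -> : dist2 y y' = dist2 (y - q) (y' - q).
    by rewrite /dist2 opprB addrA subrK.
  by rewrite /dist2; move: (y - q) (y' - q) => x x';
    rewrite !dotvE (dotvC x' x); ring.
(* All faces share the same [N] vertices, and each face loses at most [m + m + 2] cells. *)
have count N (N0 : (0 < N)%N) :
    \sum_i theta i * N%:R / (2 * pi) <= (N + k * (m + m + 2))%:R.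
  pose A i := [set n : 'I_N |
    `[< exists2 t : R, D i t & G i t = dir (2 * pi / N%:R * n%:R) >]]%SET.
  apply: le_trans (_ : (\sum_i (#|A i| + (m + m + 2)))%:R <= _).
    rewrite natr_sum ler_sum// => i _.
    have /(_ N0 (Gspeed i)) := @card_roots_on_arcs R N (theta i) (S i) (G i).
    rewrite (hS i).1 -addnA; apply => s t Ds Dt /(Ginj _ _ _ _ Ds Dt).
    by apply: (arc_inj fanP r0); [exact: Ds.1|exact: Dt.1].
  rewrite ler_nat big_split/= sum_nat_const card_ord leq_add2r.
  (* A vertex reached from two faces would, by injectivity of [f], come from a common point of two
     disjoint arcs. *)
  rewrite -[leqRHS]card_ord; apply: sum_card_disjoint => i j n.
  rewrite !inE => -[s Ds Gs] [t Dt Gt].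
  apply: (arcs_disjoint fanP r0 inF Ds.1 Dt.1).
  by apply: Ginj => //; rewrite Gs Gt.
pose Theta := \sum_i theta i.
(* Negative curvature says that the total angle [Theta] exceeds [2 * pi]. *)
have Th : 0 < Theta / (2 * pi) - 1.
  rewrite subr_gt0 ltr_pdivlMr ?mulr_gt0 ?pi_gt0// mul1r.
  by rewrite -subr_lt0.
pose K := (k * (m + m + 2))%N.
(* Large enough for the surplus [N * (Theta / (2 * pi) - 1)] to exceed the loss [K], which does not
   depend on [N]. *)
pose N := (Num.truncn (K%:R / (Theta / (2 * pi) - 1))).+1.
have := count N isT; rewrite -!mulr_suml -/Theta natrD -/K.
apply/negP; rewrite -ltNge.
have : K%:R / (Theta / (2 * pi) - 1) < N%:R by exact: truncnS_gt.
rewrite ltr_pdivrMr// mulrBr mulr1 ltrBrDl => /lt_le_trans; apply.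
by rewrite mulrCA mulrA.
Qed.
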